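(* Let $\alpha,\beta,\gamma$ be the three roots of $x^3-x-1$, labeled so that $\begin{vmatrix}\alpha^2&\alpha&1\\ \beta^2&\beta&1\\ \gamma^2&\gamma&1\end{vmatrix}=i\sqrt{23}$. Then for all integers $p$, $q$ and all complex $y$, \[ \sum_{j = 0}^\infty \frac{P_{pj + q}}{j!} y^j = \frac{ - i}{\sqrt{23}}\begin{vmatrix} \alpha^{q + 4} e^{\alpha^p y} & \alpha & 1 \\ \beta^{q + 4} e^{\beta^p y} & \beta & 1 \\ \gamma^{q + 4} e^{\gamma^p y} & \gamma & 1 \end{vmatrix} \] and \[ \sum_{j = 0}^\infty \frac{Q_{pj + q}}{j!}y^j = \frac{ - i}{\sqrt{23}}\begin{vmatrix} (2\alpha^{q + 2} + \alpha^{q - 1} )e^{\alpha^p y} & \alpha & 1 \\ (2\beta^{q + 2} + \beta^{q - 1} )e^{\beta^p y} & \beta & 1 \\ (2\gamma^{q + 2} + \gamma^{q - 1} )e^{\gamma^p y} & \gamma & 1 \end{vmatrix}. \]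
   Context: The Padovan numbers $P_n$ are defined for all integers $n$ by $P_0=P_1=P_2=1$ and $P_n=P_{n-2}+P_{n-3}$ for all integers $n$ (extended to negative indices via $P_n=P_{n+3}-P_{n+1}$). The Perrin numbers $Q_n$ are defined for all integers $n$ by $Q_0=3$, $Q_1=0$, $Q_2=2$ and $Q_n=Q_{n-2}+Q_{n-3}$ for all integers $n$. *)

(* Defs.v *)
From HB Require Import structures.
From mathcomp Require Import all_boot all_order all_algebra.
From mathcomp Require Import all_classical all_reals all_analysis.
From mathcomp Require Import complex.

Set Implicit Arguments.
Unset Strict Implicit.
Unset Printing Implicit Defensive.

Import Order.TTheory GRing.Theory Num.Theory.
Import numFieldNormedType.Exports.

Local Open Scope classical_set_scope.
Local Open Scope ring_scope.
Local Open Scope complex_scope.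

(* [a, b, c] are three consecutive terms of a sequence satisfying
   [u n = u (n - 2) + u (n - 3)]; the window moves by [n] steps to the right
   (resp. to the left, using [u n = u (n + 3) - u (n + 1)]). *)
Fixpoint rec_fwd (a b c : int) (n : nat) : int :=
  if n is m.+1 then rec_fwd b c (a + b) m else a.

Fixpoint rec_bwd (a b c : int) (n : nat) : int :=
  if n is m.+1 then rec_bwd (c - a) a b m else a.

Definition rec_int (a b c : int) (n : int) : int :=
  match n with
  | Posz m => rec_fwd a b c m
  | Negz m => rec_bwd a b c m.+1
  end.

Definition padovan : int -> int := rec_int 1 1 1.

Definition perrin : int -> int := rec_int 3 0 2.

Lemma rec_fwdE a b c n :
  rec_fwd a b c n.+3 = rec_fwd a b c n.+1 + rec_fwd a b c n.
Proof.
elim: n a b c => [|n IHn] a b c; first by rewrite /= addrC.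
exact: (IHn b c (a + b)).
Qed.

Lemma rec_bwdE a b c n :
  rec_bwd a b c n.+3 = rec_bwd a b c n - rec_bwd a b c n.+2.
Proof.
elim: n a b c => [|n IHn] a b c; last exact: (IHn (c - a) a b).
by rewrite /= opprB addrC.
Qed.

Lemma rec_intE a b c (n : int) :
  rec_int a b c n = rec_int a b c (n - 2) + rec_int a b c (n - 3).
Proof.
case: n => [[|[|[|n]]]|n].
- by rewrite /= addrC subrK.
- by rewrite [LHS]/= [RHS]/= addrC subrK.
- by rewrite [LHS]/= [RHS]/= addrC subrK.
- have -> : n.+3%:Z - 2 = n.+1%:Z by rewrite subzn.
  have -> : n.+3%:Z - 3 = n%:Z by rewrite subzn // !subSS subn0.
  exact: rec_fwdE.
- have -> : Negz n - 2 = Negz n.+2 by rewrite !NegzE -opprD -PoszD addn2.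
  have -> : Negz n - 3 = Negz n.+3 by rewrite !NegzE -opprD -PoszD addn3.
  by rewrite /rec_int (rec_bwdE _ _ _ n.+1) addrC subrK.
Qed.

Lemma padovanE n : padovan n = padovan (n - 2) + padovan (n - 3).
Proof. exact: rec_intE. Qed.

Lemma perrinE n : perrin n = perrin (n - 2) + perrin (n - 3).
Proof. exact: rec_intE. Qed.

(* The topology and norm on [R[i]] are those of any [numFieldType], which the
   library attaches to the regular algebra [R[i]^o]. *)
HB.instance Definition _ (R : realType) := NormedModule.copy R[i] R[i]^o.

(* Same definition as [expR], over the complex numbers. *)
Definition expC (R : realType) (z : R[i]) : R[i] :=
  limn (series (fun n => z ^+ n / n`!%:R)).

Definition mx3 (R : pzRingType) (a b c d e f g h k : R) : 'M[R]_3 :=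
  \matrix_(i, j) nth 0 (nth [::] [:: [:: a; b; c]; [:: d; e; f]; [:: g; h; k]] i) j.

(* Main.v *)
(** Expanding the determinants along their first column shows that
    [x, y, z |-> (i sqrt 23)^-1 * det (x a 1; y b 1; z c 1)] is the linear form
    which, at [x = f(a)], [y = f(b)], [z = f(c)], picks the coefficient of [X^2]
    in the remainder of [f] modulo [X^3 - X - 1]. Evaluated on [X^(n+4)] and on
    [2 X^(n+2) + X^(n-1)] it gives two solutions of the recurrence, whose values
    at [n = 0, 1, 2] are those of the Padovan and Perrin sequences. This writes
    each sequence as [A a^n + B b^n + C c^n], and its exponential generating
    series along [p j + q] is then a combination of three exponential series. *)
Require Import Defs.
From mathcomp Require Import all_boot all_order all_algebra.
From mathcomp Require Import all_classical all_reals all_analysis.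
From mathcomp Require Import complex ring.
Import Order.TTheory GRing.Theory Num.Theory.
Import numFieldNormedType.Exports.
Local Open Scope classical_set_scope.
Local Open Scope ring_scope.
Local Open Scope complex_scope.

Lemma normc_le_ReIm (R : realType) (z : R[i]) :
  `|z| <= (`|complex.Re z| + `|complex.Im z|)%:C.
Proof.
rewrite {1}(complexE z) (le_trans (ler_normD _ _)) // normrM.
rewrite rmorphD /= !normc_def /= !(expr0n, addr0, add0r, expr1n) /=.
by rewrite sqrtr1 mul1r !sqrtr_sqr.
Qed.

Lemma cvg_complex (R : realType) (u : nat -> R[i]) (z : R[i]) :
  (fun n => complex.Re (u n)) @ \oo --> complex.Re z ->
  (fun n => complex.Im (u n)) @ \oo --> complex.Im z -> u @ \oo --> z.
Proof.
move=> /cvgrPdist_lt uRe /cvgrPdist_lt uIm; apply/cvgrPdist_lt => e e0.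
(* In the order on [R[i]] a positive [e] is real, so it can be halved between the real and imaginary
   parts. *)
have eE : e = (complex.Re e)%:C by rewrite RRe_real // gtr0_real.
have e2 : 0 < complex.Re e / 2 by rewrite divr_gt0 // -ltcR -eE.
near=> n; apply: (le_lt_trans (@normc_le_ReIm R (z - u n))); rewrite eE ltcR.
rewrite [ltRHS]splitr !raddfB; apply: ltrD; near: n; [exact: uRe|exact: uIm].
Unshelve. all: by end_near.
Qed.

(** Both coordinates of [u] are dominated by [v], so their series converge absolutely in [R]. *)
Lemma normc_cvg_series (R : realType) (u : nat -> R[i]) (v : nat -> R) :
  (forall n, `|u n| <= (v n)%:C) -> cvgn (series v) -> cvgn (series u).
Proof.
move=> uv cv.
have v0 n : 0 <= v n by rewrite -ler0c (le_trans _ (uv n)).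
have dominated (w : nat -> R) : (forall n, `|w n| <= v n) -> cvgn (series w).
  by move=> wv; apply: normed_cvg; apply: (series_le_cvg _ v0 wv cv) => n;
    exact: normr_ge0.
have cRe : cvgn (series (fun n => complex.Re (u n))).
  by apply: dominated => n; rewrite -lecR (le_trans (normc_ge_Re _)).
have cIm : cvgn (series (fun n => complex.Im (u n))).
  apply: dominated => n; rewrite -lecR (le_trans _ (uv n)) // normc_def lecR.
  by rewrite -sqrtr_sqr ler_wsqrtr // lerDr sqr_ge0.
apply: (cvgP (limn (series (fun n => complex.Re (u n))) +i*
              limn (series (fun n => complex.Im (u n))))).
have ReE n : complex.Re (series u n) = series (fun n => complex.Re (u n)) n.
  by rewrite /series /= raddf_sum.
have ImE n : complex.Im (series u n) = series (fun n => complex.Im (u n)) n.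
  by rewrite /series /= raddf_sum.
by apply: cvg_complex; under eq_fun do rewrite ?ReE ?ImE.
Qed.

(** [expC] is a [limn], which is meaningful only once convergence is known; the real exponential
    series at the modulus of [z] dominates. *)
Lemma cvg_expC (R : realType) (z : R[i]) :
  series (fun n => z ^+ n / n`!%:R) @ \oo --> expC z.
Proof.
apply: (@normc_cvg_series _ _ (exp_coeff (complex.Re `|z|))).
  move=> n; rewrite normrM normfV normrX normr_nat /exp_coeff /=.
  have zE : `|z| = (complex.Re `|z|)%:C by rewrite normc_def.
  by rewrite [in leLHS]zE -rmorphXn -(rmorph_nat (real_complex R))
             -fmorphV -rmorphM.
exact: is_cvg_series_exp_coeff.
Qed.

(** Moving the window by one step amounts to shifting the argument of [f], so the induction
    generalizes both [f] and the initial values. *)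
Lemma rec_int_unique (V : pzRingType) (f : int -> V) (x y z : int) :
  (forall n, f (n + 3) = f (n + 1) + f n) ->
  f 0 = x%:~R -> f 1 = y%:~R -> f 2 = z%:~R ->
  forall n, (rec_int x y z n)%:~R = f n.
Proof.
move=> frec f0 f1 f2 [] n; rewrite /rec_int.
  elim: n x y z f frec f0 f1 f2 => [|n IHn] x y z f frec f0 f1 f2 //=.
  rewrite (IHn _ _ _ (fun k => f (k + 1))) //.
  - by rewrite -PoszD addn1.
  - by move=> k; rewrite [k + 3 + 1]addrAC frec.
  - by rewrite (frec 0) f0 f1 rmorphD addrC.
(* With [n.+1] generalized, the backward induction can start at 0. *)
rewrite NegzE; move: n.+1 => {}n.
elim: n x y z f frec f0 f1 f2 => [|n IHn] x y z f frec f0 f1 f2 //=.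
rewrite (IHn _ _ _ (fun k => f (k - 1))) //.
- by rewrite -opprD -PoszD addn1.
- by move=> k; rewrite !(addrAC k _ (-1)) frec.
- have := frec (-1); rewrite f2 f0 => /eqP.
  by rewrite rmorphB addrC -subr_eq => /eqP ->.
Qed.

Lemma det_mx3 (K : comPzRingType) (x1 a1 x2 a2 x3 a3 : K) :
  \det (mx3 x1 a1 1 x2 a2 1 x3 a3 1) =
  x1 * (a2 - a3) + x2 * (a3 - a1) + x3 * (a1 - a2).
Proof.
rewrite (expand_det_col _ ord0) !big_ord_recl big_ord0 /cofactor.
rewrite !(expand_det_row _ ord0) !big_ord_recl !big_ord0 /cofactor.
by rewrite !det_mx11 !mxE /= /bump /=; ring.
Qed.

Lemma rec_int_roots (K : fieldType) (A B C a b c : K) (x y z : int) :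
  a != 0 -> b != 0 -> c != 0 ->
  a ^+ 3 = a + 1 -> b ^+ 3 = b + 1 -> c ^+ 3 = c + 1 ->
  A + B + C = x%:~R -> A * a + B * b + C * c = y%:~R ->
  A * a ^+ 2 + B * b ^+ 2 + C * c ^+ 2 = z%:~R ->
  forall n, (rec_int x y z n)%:~R = A * a ^ n + B * b ^ n + C * c ^ n.
Proof.
move=> a0 b0 c0 aE bE cE E0 E1 E2.
have step (t : K) : t != 0 -> t ^+ 3 = t + 1 ->
    forall n : int, t ^ (n + 3) = t ^ (n + 1) + t ^ n.
  move=> t0 tE n; rewrite (expfzDr n 3 t0) (expfzDr n 1 t0).
  by rewrite -[t ^ 3]/(t ^+ 3) tE expr1z; ring.
apply: (@rec_int_unique K (fun n => A * a ^ n + B * b ^ n + C * c ^ n)) => //.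
  by move=> n; rewrite !step //; ring.
by rewrite !expr0z !mulr1.
Qed.

Lemma mul_det_mx3 (K : comPzRingType) (w a b c fa fb fc pa pb pc ea eb ec : K) :
  w * \det (mx3 (fa * pa * ea) a 1 (fb * pb * eb) b 1 (fc * pc * ec) c 1) =
  w * (b - c) * fa * pa * ea + w * (c - a) * fb * pb * eb +
  w * (a - b) * fc * pc * ec.
Proof. by rewrite det_mx3; ring. Qed.

Lemma padovan_roots (K : fieldType) (w a b c : K) :
  a != 0 -> b != 0 -> c != 0 ->
  a ^+ 3 = a + 1 -> b ^+ 3 = b + 1 -> c ^+ 3 = c + 1 ->
  w * \det (mx3 (a ^+ 2) a 1 (b ^+ 2) b 1 (c ^+ 2) c 1) = 1 ->
  forall n, (padovan n)%:~R = w * (b - c) * a ^+ 4 * a ^ n +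
    w * (c - a) * b ^+ 4 * b ^ n + w * (a - b) * c ^+ 4 * c ^ n.
Proof.
move=> a0 b0 c0 aE bE cE; rewrite det_mx3 => w1 n.
have pow4 (t : K) : t ^+ 3 = t + 1 -> t ^+ 4 = t ^+ 2 + t.
  by move=> tE; rewrite exprS tE; ring.
(* Modulo X^3 - X - 1, the powers X^4, X^5, X^6 are X^2 + X, X^2 + X + 1, X^2 + 2X + 1: the
   coefficient of X^2 is always 1. *)
by apply: rec_int_roots; rewrite // !pow4 // -[RHS]w1; ring: aE bE cE.
Qed.

Lemma perrin_roots (K : fieldType) (w a b c : K) :
  a != 0 -> b != 0 -> c != 0 ->
  a ^+ 3 = a + 1 -> b ^+ 3 = b + 1 -> c ^+ 3 = c + 1 ->
  w * \det (mx3 (a ^+ 2) a 1 (b ^+ 2) b 1 (c ^+ 2) c 1) = 1 ->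
  forall n, (perrin n)%:~R = w * (b - c) * (2 * a ^+ 2 + a^-1) * a ^ n +
    w * (c - a) * (2 * b ^+ 2 + b^-1) * b ^ n +
    w * (a - b) * (2 * c ^+ 2 + c^-1) * c ^ n.
Proof.
move=> a0 b0 c0 aE bE cE; rewrite det_mx3 => w1 n.
have inv (t : K) : t != 0 -> t ^+ 3 = t + 1 -> t^-1 = t ^+ 2 - 1.
  by move=> t0 tE; apply: (mulfI t0); rewrite mulfV // mulrBr -exprS tE; ring.
(* Here 2X^2 + X^-1 becomes 3X^2 - 1; times 1, X, X^2 it reduces to 3X^2 - 1, 2X + 3, 2X^2 + 3X,
   with X^2-coefficients 3, 0, 2. Writing each value as itself times the normalized determinant
   leaves an identity for [ring]. *)
by apply: rec_int_roots; rewrite // !inv // -[RHS]mulr1 -[X in _ = _ * X]w1;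
   ring: aE bE cE.
Qed.

Lemma expfzD4 (K : fieldType) (x : K) (q : int) :
  x != 0 -> x ^ (q + 4) = x ^+ 4 * x ^ q.
Proof. by move=> x0; rewrite addrC expfzDr. Qed.

Lemma expfzD2B1 (K : fieldType) (x : K) (q : int) :
  x != 0 -> 2 * x ^ (q + 2) + x ^ (q - 1) = (2 * x ^+ 2 + x^-1) * x ^ q.
Proof.
move=> x0; rewrite (expfzDr q 2 x0) (expfzDr q (-1) x0).
by rewrite [RHS]mulrDl -[in RHS]mulrA !(mulrC (x ^ q)).
Qed.

Lemma cvg_exp_gen_fun (R : realType) (s : int -> int)
    (A B C a b c : R[i]) (p q : int) (y : R[i]) :
  a != 0 -> b != 0 -> c != 0 ->
  (forall n, (s n)%:~R = A * a ^ n + B * b ^ n + C * c ^ n) ->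
  series (fun j : nat => (s (p * j%:Z + q))%:~R / j`!%:R * y ^+ j) @ \oo -->
  A * a ^ q * expC (a ^ p * y) + B * b ^ q * expC (b ^ p * y) +
  C * c ^ q * expC (c ^ p * y).
Proof.
move=> a0 b0 c0 sE.
pose e x := series (fun n => x ^+ n / n`!%:R) : nat -> R[i].
(* The partial sums already agree, because a^(pj+q) = a^q (a^p)^j; only finite sums are
   rearranged. *)
have -> : series (fun j : nat => (s (p * j%:Z + q))%:~R / j`!%:R * y ^+ j) =
    (fun n => A * a ^ q * e (a ^ p * y) n + B * b ^ q * e (b ^ p * y) n +
              C * c ^ q * e (c ^ p * y) n).
  apply/funext => n; rewrite /e /series /= !mulr_sumr -!big_split /=.
  apply: eq_bigr => j _.
  rewrite sE !expfzDr // -!exprz_exp !exprMn -!exprnP.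
  move: (a ^ q) (b ^ q) (c ^ q) (a ^ p) (b ^ p) (c ^ p) (j`!%:R^-1) => *.
  ring.
have ce d x : (fun n => d * e x n) @ \oo --> d * expC x.
  exact: (cvgM (cvg_cst d) (@cvg_expC _ _)).
exact: (cvgD (cvgD (ce _ _) (ce _ _)) (ce _ _)).
Qed.

Theorem theorem11 (R : realType) (a b c : R[i])
    (roots_abc : 'X^3 - 'X - 1 = ('X - a%:P) * ('X - b%:P) * ('X - c%:P))
    (label_abc : \det (mx3 (a ^+ 2) a 1
                           (b ^+ 2) b 1
                           (c ^+ 2) c 1) = 'i * (Num.sqrt 23)%:C)
    (p q : int) (y : R[i]) :
  series (fun j : nat => (padovan (p * j%:Z + q))%:~R / j`!%:R * y ^+ j) @ \oo
    --> - 'i / (Num.sqrt 23)%:C *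
        \det (mx3 (a ^ (q + 4) * expC (a ^ p * y)) a 1
                  (b ^ (q + 4) * expC (b ^ p * y)) b 1
                  (c ^ (q + 4) * expC (c ^ p * y)) c 1)
  /\
  series (fun j : nat => (perrin (p * j%:Z + q))%:~R / j`!%:R * y ^+ j) @ \oo
    --> - 'i / (Num.sqrt 23)%:C *
        \det (mx3 ((2 * a ^ (q + 2) + a ^ (q - 1)) * expC (a ^ p * y)) a 1
                  ((2 * b ^ (q + 2) + b ^ (q - 1)) * expC (b ^ p * y)) b 1
                  ((2 * c ^ (q + 2) + c ^ (q - 1)) * expC (c ^ p * y)) c 1).
Proof.
set w := - 'i / (Num.sqrt 23)%:C.
have w1 : w * ('i * (Num.sqrt 23)%:C) = 1.
  have s0 : (Num.sqrt 23 : R)%:C != 0.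
    by rewrite (inj_eq (@complexI R)) sqrtr_eq0 -ltNge.
  by rewrite /w mulrACA mulVf // mulr1 mulNr -expr2 sqr_i opprK.
(* From here on [w] is only known as the inverse of the labeling determinant; the value i sqrt 23 no
   longer matters. *)
clearbody w; rewrite -label_abc in w1.
have rootE x : x \in [:: a; b; c] -> x ^+ 3 = x + 1.
  move=> xabc; apply/eqP; rewrite -subr_eq0 opprD addrA.
  have <- : ('X^3 - 'X - 1 : {poly R[i]}).[x] = x ^+ 3 - x - 1.
    by rewrite !hornerE.
  rewrite roots_abc !hornerE !mulf_eq0 !subr_eq0.
  by move: xabc; rewrite !inE -orbA.
(* Zero is not a root, as 0 = 0 + 1 fails; this makes negative exponents harmless. *)
have root0 x : x \in [:: a; b; c] -> x != 0.
  move=> /rootE; apply: contra_eq_neq => ->.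
  by rewrite expr0n add0r eq_sym oner_neq0.
have [aE bE cE] : [/\ a ^+ 3 = a + 1, b ^+ 3 = b + 1 & c ^+ 3 = c + 1].
  by split; apply: rootE; rewrite !inE eqxx ?orbT.
have [a0 b0 c0] : [/\ a != 0, b != 0 & c != 0].
  by split; apply: root0; rewrite !inE eqxx ?orbT.
split.
  rewrite !expfzD4 // mul_det_mx3.
  by apply: cvg_exp_gen_fun => //; exact: padovan_roots.
rewrite !expfzD2B1 // mul_det_mx3.
by apply: cvg_exp_gen_fun => //; exact: perrin_roots.
Qed.
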